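(* Let $\mathcal{P}=(\mathcal{P}_x)_{x\in\mathbb{R}}$ be an additive noise channel, i.e. $\mathcal{P}_x$ is the law of $x+z$ for $z\sim\rho$, where $\rho$ is a probability measure on $\mathbb{R}$ having a density $p$ with respect to Lebesgue measure with $p(y)>0$ for all $y\in\mathbb{R}$, $p$ of class $C^4$ on $\mathbb{R}$, and $p(y)=p(-y)$ for all $y\in\mathbb{R}$. Then the quantized channel $\mathrm{sgn}(\mathcal{P})$ satisfies: (C1) for every $A>0$, $R_{\mathrm{sgn}(\mathcal{P})}(x^{(1)},x^{(2)})$ is $C^4$ in an open set containing $[-A,A]^2$; (C2) $\frac{\partial^3R_{\mathrm{sgn}(\mathcal{P})}}{\partial(x^{(1)})^2\,\partial x^{(2)}}(0,0)=0$; and it has Fisher information $F_{\mathrm{sgn}(\mathcal{P})}=4p(0)^2$.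
   Context: The quantized version $\mathrm{sgn}(\mathcal{P})$ of a channel $\mathcal{P}$ with real outputs (each $\mathcal{P}_x$ absolutely continuous with respect to Lebesgue measure) is the channel with range $\{-1,1\}$ in which a sample from $\mathrm{sgn}(\mathcal{P})_x$ is $\mathrm{sgn}(y)$ for $y\sim\mathcal{P}_x$ (the value $0$ may be mapped arbitrarily). For a channel $\mathcal{P}'=(\mathcal{P}'_x)$ with $\mathcal{P}'_x\ll\mathcal{P}'_0$ and $d\mathcal{P}'_x/d\mathcal{P}'_0\in L^2(\mathcal{P}'_0)$, the channel overlap is $R_{\mathcal{P}'}(x^{(1)},x^{(2)})=\mathbb{E}_{y\sim\mathcal{P}'_0}\left[\left(\frac{d\mathcal{P}'_{x^{(1)}}}{d\mathcal{P}'_0}(y)-1\right)\left(\frac{d\mathcal{P}'_{x^{(2)}}}{d\mathcal{P}'_0}(y)-1\right)\right]$, and the Fisher information is $F_{\mathcal{P}'}=\frac{\partial^2R_{\mathcal{P}'}}{\partial x^{(1)}\partial x^{(2)}}(0,0)$. *)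

(* Defs.v *)
From HB Require Import structures.
From mathcomp Require Import all_boot all_order all_algebra.
From mathcomp Require Import all_classical all_reals all_analysis.
From mathcomp Require Import measurable_realfun.

Set Implicit Arguments.
Unset Strict Implicit.
Unset Printing Implicit Defensive.

Import Order.TTheory GRing.Theory Num.Theory.
Import numFieldNormedType.Exports.

Local Open Scope classical_set_scope.
Local Open Scope ring_scope.

Definition C_on_R {R : realType} (k : nat) (f : R -> R) : Prop :=
  (forall j, (j < k)%N -> forall x, derivable (f^`(j))%classic x 1) /\
  continuous (f^`(k))%classic.

Definition partial1 {R : realType} (f : R * R -> R) : R * R -> R :=
  'D_((1, 0) : R * R) f.

Definition partial2 {R : realType} (f : R * R -> R) : R * R -> R :=
  'D_((0, 1) : R * R) f.

(* Used for open U only. All mixed partial derivatives of order at most k, taken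
   in any order, exist and are continuous at the points of U. *)
Fixpoint C_on {R : realType} (k : nat) (U : set (R * R)) (f : R * R -> R)
    : Prop :=
  {in U, continuous f} /\
  if k is k'.+1 then
    [/\ forall u, U u -> derivable f u (1, 0),
        forall u, U u -> derivable f u (0, 1),
        C_on k' U (partial1 f) &
        C_on k' U (partial2 f)]
  else True.

Definition channel (d : measure_display) (Y : measurableType d) (R : realType) :=
  R -> probability Y R.

Section channel_overlap.
Context {d : measure_display} {Y : measurableType d} {R : realType}.
Variable P : channel Y R.

Definition channel_density (x : R) : Y -> R :=
  fun y => fine (Radon_Nikodym (charge_of_finite_measure (P x)) (P 0) y).

Definition has_overlap : Prop :=
  forall x, P x `<< P 0 /\ channel_density x \in Lfun (P 0) 2%:E.

Definition overlap (x : R * R) : R :=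
  \int[P 0]_y ((channel_density x.1 y - 1) * (channel_density x.2 y - 1)).

Definition fisher_information : R := partial1 (partial2 overlap) (0, 0).

End channel_overlap.

Section additive_noise.
Context {R : realType}.

Definition translate (x : R) : R -> R := fun z => x + z.

Lemma measurable_translate (x : R) : measurable_fun [set: R] (translate x).
Proof. exact: measurable_funD. Qed.

HB.instance Definition _ (x : R) :=
  isMeasurableFun.Build _ _ _ _ (translate x) (measurable_translate x).

Definition additive_noise (rho : probability R R) : channel R R :=
  fun x => distribution rho (translate x).

End additive_noise.

Section quantization.
Context {R : realType}.

(* The sign with 0 sent to (-1) ^+ b, i.e. to 1 if b is false, -1 if b is true. *)
Definition sgn_pm (b : bool) (y : R) : R :=
  if y == 0 then (-1) ^+ b else Num.sg y.

Lemma measurable_sgn_pm (b : bool) : measurable_fun [set: R] (sgn_pm b).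
Proof.
have -> : sgn_pm b = fun y : R =>
    if y == 0 then (-1) ^+ b else if 0 < y then 1 else -1.
  apply/funext => y; rewrite /sgn_pm; case: ifPn => // y_neq0.
  case: ifPn => [/gtr0_sg //|]; rewrite -leNgt le_eqVlt (negbTE y_neq0) /=.
  exact: ltr0_sg.
apply: measurable_fun_ifT => //.
  exact: measurable_fun_eqr.
apply: measurable_fun_ifT => //.
exact: measurable_fun_ltr.
Qed.

HB.instance Definition _ (b : bool) :=
  isMeasurableFun.Build _ _ _ _ (sgn_pm b) (measurable_sgn_pm b).

Definition quantize (b : bool) (P : channel R R) : channel R R :=
  fun x => distribution (P x) (sgn_pm b).

End quantization.

(* Main.v *)
Require Import Defs.
From mathcomp Require Import all_boot all_order all_algebra.
From mathcomp Require Import all_classical all_reals all_analysis.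
From mathcomp Require Import measurable_realfun ring lra.

(** A channel with outputs in {1, -1} is determined by one number per input.
    With F the distribution function of the noise, the quantized channel sends
    the input x to -1 with probability F(-x) and to 1 with probability
    1 - F(-x), and evenness of the density p makes the input 0 give a fair
    coin.  This coin charges both outputs, so it dominates the law Q_x of the
    output on every input x.  The density of Q_x with respect to Q_0 is
    1 + 2 g(x) at 1 and 1 - 2 g(x) at -1, where g(x) = 1/2 - F(-x), and
    averaging over the coin separates the variables ([overlap_quantize]):

      R(x, y) = ((2 g(x)) (2 g(y)) + (- 2 g(x)) (- 2 g(y))) / 2 = 4 g(x) g(y).

    By the fundamental theorem of calculus and evenness,
    g'(x) = p(-x) = p(x) ([derive_centered_cdf]).  So g is of class C^5, and the
    mixed partial derivatives of R are products of derivatives of g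
    ([partial1_separable], [partial2_separable], [C_on_separable]): R is C^4
    on the whole plane, the Fisher information is 4 g'(0)^2 = 4 p(0)^2, and the
    third derivative in question is 4 g''(0) g'(0) = 4 p'(0) p(0), which
    vanishes because the derivative of an even function is odd. *)

Set Implicit Arguments.
Unset Strict Implicit.
Unset Printing Implicit Defensive.

Import Order.TTheory GRing.Theory Num.Theory.
Import numFieldNormedType.Exports.

Local Open Scope classical_set_scope.
Local Open Scope ring_scope.

(** * Functions of two variables with separated variables *)

(** Stated for the difference quotients, so that it transfers both the
    existence and the value of a partial derivative to a derivative in one
    variable. *)
Lemma quotient_slice1 (R : realType) (f : R * R -> R) (z : R * R) :
  (fun h : R => h^-1 *: ((f \o shift z) (h *: (1, 0)) - f z)) =
  (fun h : R => h^-1 *: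
     (((fun t => f (t, z.2)) \o shift z.1) (h *: 1) - f (z.1, z.2))).
Proof.
case: z => x y; apply/funext => h.
suff -> : (f \o shift (x, y)) (h *: (1, 0)) =
          ((fun t => f (t, y)) \o shift x) (h *: 1) by [].
by rewrite /= /shift; congr (f _); congr pair; rewrite /= scaler0 add0r.
Qed.

Lemma quotient_slice2 (R : realType) (f : R * R -> R) (z : R * R) :
  (fun h : R => h^-1 *: ((f \o shift z) (h *: (0, 1)) - f z)) =
  (fun h : R => h^-1 *:
     (((fun t => f (z.1, t)) \o shift z.2) (h *: 1) - f (z.1, z.2))).
Proof.
case: z => x y; apply/funext => h.
suff -> : (f \o shift (x, y)) (h *: (0, 1)) =
          ((fun t => f (x, t)) \o shift y) (h *: 1) by [].
by rewrite /= /shift; congr (f _); congr pair; rewrite /= scaler0 add0r.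
Qed.

Section separable.
Context (R : realType).
Implicit Types (u v : R -> R) (c : R).

Definition separable c u v : R * R -> R := fun z => c * u z.1 * v z.2.

Lemma derivable1_separable c u v (z : R * R) :
  derivable u z.1 1 -> derivable (separable c u v) z (1, 0).
Proof.
move=> du; rewrite /derivable quotient_slice1 -/(derivable _ z.1 1).
have -> : (fun t => separable c u v (t, z.2)) = (c * v z.2) \*: u.
  by apply/funext => t; rewrite /separable/= mulrAC.
exact: derivableZ.
Qed.

Lemma derivable2_separable c u v (z : R * R) :
  derivable v z.2 1 -> derivable (separable c u v) z (0, 1).
Proof.
move=> dv; rewrite /derivable quotient_slice2 -/(derivable _ z.2 1).
exact: (@derivableZ _ _ _ v (c * u z.1)).
Qed.

Lemma partial1_separable c u v :
  (forall x, derivable u x 1) ->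
  partial1 (separable c u v) = separable c (u^`())%classic v.
Proof.
move=> du; apply/funext => z.
rewrite /partial1 /derive quotient_slice1 -/(derive _ z.1 1).
have -> : (fun t => separable c u v (t, z.2)) = (c * v z.2) \*: u.
  by apply/funext => t; rewrite /separable/= mulrAC.
by rewrite deriveZ// -derive1E /separable mulrAC.
Qed.

Lemma partial2_separable c u v :
  (forall x, derivable v x 1) ->
  partial2 (separable c u v) = separable c u (v^`())%classic.
Proof.
move=> dv; apply/funext => z.
rewrite /partial2 /derive quotient_slice2 -/(derive _ z.2 1).
by rewrite (@deriveZ _ _ _ v (c * u z.1))// -derive1E.
Qed.

Lemma C_on_R_continuous k u : C_on_R k u -> continuous u.
Proof.
case: k => [[_ //]|k [du _]] x.
by apply/differentiable_continuous/derivable1_diffP; exact: (du 0%N).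
Qed.

Lemma C_on_RS k u :
  C_on_R k.+1 u <-> (forall x, derivable u x 1) /\ C_on_R k (u^`())%classic.
Proof.
split=> [[du cu]|[du [du' cu']]].
  split; first exact: (du 0%N).
  split; last by rewrite -derive1Sn.
  by move=> j jk x; rewrite -derive1Sn; exact: du.
split; last by rewrite derive1Sn.
case=> [//|j jk x]; rewrite derive1Sn; exact: du'.
Qed.

Lemma C_on_RW k u : C_on_R k.+1 u -> C_on_R k u.
Proof.
move=> ck; split=> [j jk x|]; first by apply: ck.1; rewrite ltnW.
move=> x; apply/differentiable_continuous/derivable1_diffP.
exact: ck.1.
Qed.

Lemma continuous_separable c u v :
  continuous u -> continuous v -> continuous (separable c u v).
Proof.
move=> cu cv z.
apply: (@continuousM _ (R * R)%type (fun z => c * u z.1) (v \o snd)).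
  apply: (@continuousM _ (R * R)%type (cst c) (u \o fst)).
    exact: cst_continuous.
  by apply: continuous_comp; [exact: cvg_fst|exact: cu].
by apply: continuous_comp; [exact: cvg_snd|exact: cv].
Qed.

(** Differentiating one factor keeps the variables separated, so a single
    induction on the order covers the mixed partial derivatives in every
    order of differentiation. *)
Lemma C_on_separable k c u v : C_on_R k u -> C_on_R k v ->
  C_on k [set: R * R] (separable c u v).
Proof.
elim: k u v => [|k IH] u v cu cv.
  by split=> // z _; exact: (continuous_separable cu.2 cv.2).
split=> [z _|].
  exact: (continuous_separable (C_on_R_continuous cu) (C_on_R_continuous cv)).
have [du cu'] := (C_on_RS _ _).1 cu.
have [dv cv'] := (C_on_RS _ _).1 cv.
split.
- by move=> z _; exact: derivable1_separable.
- by move=> z _; exact: derivable2_separable.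
- rewrite (partial1_separable _ _ du); exact: (IH _ _ cu' (C_on_RW cv)).
- rewrite (partial2_separable _ _ dv); exact: (IH _ _ (C_on_RW cu) cv').
Qed.

End separable.

Lemma derive1_even0 (R : realType) (p : R -> R) :
  (forall x, derivable p x 1) -> (forall y, p y = p (- y)) ->
  (p^`())%classic 0 = 0.
Proof.
move=> dp pe.
have : (p^`())%classic 0 = - (p^`())%classic 0.
  have {1}-> : p = p \o -%R by apply/funext => y; exact: pe.
  rewrite derive1_comp//.
  by rewrite oppr0 [X in _ * X]derive1E derive_val mulrN1.
by move=> /eqP; rewrite -addr_eq0 -mulr2n mulrn_eq0/= => /eqP.
Qed.

(** * Measures carried by two points *)

Lemma integral_atom (R : realType) (mu : {measure set R -> \bar R})
  (c : R) (f : R -> \bar R) :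
  (\int[mu]_(x in [set c]) f x = f c * mu [set c])%E.
Proof.
rewrite (eq_integral (cst (f c))); last by move=> x /set_mem ->.
by rewrite integral_cst.
Qed.

Section two_atoms.
Context (R : realType) (mu : {measure set R -> \bar R}) (a b : R).
Hypothesis ab : a != b.
Hypothesis mu_ab : mu (~` [set a; b]) = 0%E.

Lemma measurable_two_atoms : measurable [set a; b].
Proof. by apply: measurableU; exact: measurable_set1. Qed.

Lemma two_atoms_null (A : set R) : measurable A ->
  a \notin A -> b \notin A -> mu A = 0%E.
Proof.
rewrite !notin_setE => mA aA bA.
apply: (subset_measure0 mA (measurableC measurable_two_atoms)) => //.
by move=> x Ax [] xab; [apply: aA|apply: bA]; rewrite -xab.
Qed.

Lemma ge0_integral_two_atoms (f : R -> \bar R) :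
  measurable_fun setT f -> (forall x, 0 <= f x)%E ->
  (\int[mu]_x f x = f a * mu [set a] + f b * mu [set b])%E.
Proof.
move=> mf f0.
rewrite (ge0_negligible_integral (measurableC measurable_two_atoms))//.
rewrite setTD setCK ge0_integral_setU ?integral_atom//.
- exact: measurable_funTS.
- apply/disj_set2P; apply/seteqP; split => // x [->] /eqP.
  by rewrite (negbTE ab).
Qed.

End two_atoms.

Section two_atoms_finite.
Context (R : realType) (mu : {finite_measure set R -> \bar R}) (a b : R).
Hypothesis ab : a != b.
Hypothesis mu_ab : mu (~` [set a; b]) = 0%E.

Lemma integrable_two_atoms (f : R -> R) : measurable_fun setT f ->
  mu.-integrable setT (EFin \o f).
Proof.
move=> mf; apply/integrableP; split; first exact/measurable_EFinP.
rewrite (ge0_integral_two_atoms ab mu_ab)//; last first.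
  by apply: measurableT_comp => //; exact/measurable_EFinP.
by rewrite lte_add_pinfty// lte_mul_pinfty// ltey_eq fin_num_measure.
Qed.

Lemma Rintegral_two_atoms (f : R -> R) : measurable_fun setT f ->
  \int[mu]_x f x = f a * fine (mu [set a]) + f b * fine (mu [set b]).
Proof.
move=> mf; rewrite /Rintegral.
rewrite (negligible_integral (measurableC (measurable_two_atoms a b)))//;
  last exact: integrable_two_atoms.
rewrite setTD setCK integral_setU//; last 2 first.
- by apply: measurable_funTS; exact/measurable_EFinP.
- apply/disj_set2P; apply/seteqP; split => // x [->] /eqP.
  by rewrite (negbTE ab).
by rewrite !integral_atom fineD ?fineM ?fin_numM ?fin_num_measure.
Qed.

Lemma Lfun2_two_atoms (f : R -> R) :
  measurable_fun setT f -> f \in Lfun mu 2%:E.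
Proof.
move=> mf; rewrite inE; apply/andP; split; rewrite inE//=.
rewrite /finite_norm unlock poweR_lty//.
rewrite (ge0_integral_two_atoms ab mu_ab)//=; last first.
  apply/measurable_EFinP.
  apply: (@measurableT_comp _ _ _ _ _ _ (fun x : R => x `^ 2)%R) => //.
  exact: measurableT_comp.
by rewrite lte_add_pinfty// lte_mul_pinfty// ltey_eq fin_num_measure.
Qed.

End two_atoms_finite.

(** * Channel densities *)

(** A Radon-Nikodym derivative is only fixed almost everywhere, but at an atom
    of the reference measure this identity pins down its value. *)
Lemma channel_density_atom (R : realType) (P : channel R R) (x y : R) :
  P x `<< P 0 ->
  P x [set y] = ((channel_density P x y)%:E * P 0%R [set y])%E.
Proof.
move=> Pac; rewrite /channel_density fineK; last exact: Radon_Nikodym_fin_num.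
rewrite -integral_atom.
exact: (@Radon_Nikodym_integral _ _ _ (charge_of_finite_measure (P x))).
Qed.

Lemma measurable_channel_density d (Y : measurableType d) (R : realType)
  (P : channel Y R) (x : R) : P x `<< P 0 ->
  measurable_fun setT (channel_density P x).
Proof.
move=> Pac; apply: measurableT_comp; first exact: fine_measurable.
exact: measurable_int (Radon_Nikodym_integrable _).
Qed.

(** * The quantized additive noise channel *)

Definition law_cdf (R : realType) (rho : probability R R) (x : R) : R :=
  fine (rho `]-oo, x]%classic).

(** The mean of the output on input x is twice this number; by
    evenness of the noise it is also the signed mass of [0, x]. *)
Definition centered_cdf (R : realType) (rho : probability R R) (x : R) : R :=
  2^-1 - law_cdf rho (- x).

Lemma one_neqN1 (R : realType) : (1 : R) != -1.
Proof. by rewrite gt_eqF//; lra. Qed.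

Section quantized_additive_noise.
Context (R : realType) (rho : probability R R) (p : R -> R).
Hypothesis p_density : forall B : set R, measurable B ->
  rho B = (\int[lebesgue_measure]_(y in B) (p y)%:E)%E.
Hypothesis p_ge0 : forall y, 0 <= p y.
Hypothesis p_cont : continuous p.

Lemma density_point0 (x : R) : rho [set x] = 0%E.
Proof. by rewrite p_density// integral_set1. Qed.

Lemma density_integrable (D : set R) : measurable D ->
  lebesgue_measure.-integrable D (EFin \o p).
Proof.
move=> mD; apply/integrableP; split.
  apply/measurable_EFinP; apply: measurable_funTS.
  exact: continuous_measurable_fun.
under eq_integral do rewrite /= ger0_norm//.
by rewrite -p_density// ltey_eq fin_num_measure.
Qed.

Lemma derive_law_cdf (x : R) :
  derivable (law_cdf rho) x 1 /\ (law_cdf rho)^`()%classic x = p x.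
Proof.
have -> : law_cdf rho =
    fun y => (\int[lebesgue_measure]_(t in [set` `]-oo, y]]) (p t))%R.
  by apply/funext => y; rewrite /law_cdf p_density.
(* x + 1 is any point to the right of x, making x interior. *)
apply: (@continuous_FTC1 _ p -oo%O x (x + 1)); rewrite ?ltrDl ?ltNyr//.
  exact: density_integrable.
exact: p_cont.
Qed.

Lemma measure_itvNyo (x : R) : rho `]-oo, x[%classic = (law_cdf rho x)%:E.
Proof.
rewrite /law_cdf fineK ?fin_num_measure// -(@setUitv1 _ _ -oo%O x true)//.
rewrite measureU//; first by rewrite [X in (_ + X)%E]density_point0 adde0.
by apply/seteqP; split => // y [/= /[swap] ->]; rewrite in_itv/= ltxx.
Qed.

Hypothesis p_even : forall y, p y = p (- y).

(** The reflection x -> - x exchanges the two half-lines and preserves the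
    density, so they have equal mass; the point 0 has none. *)
Lemma law_cdf0 : law_cdf rho 0 = 2^-1.
Proof.
have e : rho `[0, +oo[%classic = rho `]-oo, 0]%classic.
  have := @ge0_integration_by_substitutionNy _ p 0.
  rewrite oppr0 !p_density// => ->//; last exact: continuous_subspaceT.
  by apply: eq_integral => x _ /=; rewrite -p_even.
have : rho `[0, +oo[%classic = (1 - rho `]-oo, 0%R[%classic)%E.
  by rewrite -probability_setC// setCitvl.
rewrite e measure_itvNyo -[LHS]fineK ?fin_num_measure// -/(law_cdf _ _).
by move=> [] ?; lra.
Qed.

Context (b : bool).
Let Q := quantize b (additive_noise rho).

Lemma quantizeE (x : R) (B : set R) :
  Q x B = rho [set z | B (sgn_pm b (x + z))].
Proof. by []. Qed.

Lemma sgn_pm_values (y : R) : [set 1; -1] (sgn_pm b y).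
Proof.
rewrite /sgn_pm; case: eqVneq => [_|y0]; first by case: b; [right|left].
by case: sgrP y0 => // _ _; [left|right].
Qed.

Lemma quantize_support (x : R) : Q x (~` [set 1; -1]) = 0%E.
Proof.
rewrite quantizeE (_ : [set z | _] = set0) ?measure0// -subset0 => z /=.
by apply; exact: sgn_pm_values.
Qed.

(** The preimage of -1 is a half-line whose end point belongs to it or not
    according to b; both have the same mass because the noise has no atom. *)
Lemma quantizeN1 (x : R) : Q x [set -1] = (law_cdf rho (- x))%:E.
Proof.
rewrite quantizeE.
have n11 : (1 : R) <> -1 by lra.
have e : [set z | [set -1] (sgn_pm b (x + z))] =
    if b then `]-oo, - x]%classic else `]-oo, - x[%classic.
  apply/seteqP; split => z /=; rewrite /sgn_pm; case: eqVneq => xz.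
  - have -> : z = - x by lra.
    by case: b => //= _; rewrite in_itv/=.
  - case: sgrP xz => // xz _ //.
    by case: b => //= _; rewrite in_itv/=; lra.
  - by case: b => //=; rewrite in_itv/=; lra.
  - have : (if b then z \in `]-oo, - x] else z \in `]-oo, - x[) -> z < - x.
    by case: b; rewrite in_itv/=; lra.
    case: b => /= h /h ?; rewrite ltr0_sg//; lra.
rewrite e; case: b; last exact: measure_itvNyo.
by rewrite fineK// fin_num_measure.
Qed.

Lemma quantize1 (x : R) : Q x [set 1] = (1 - law_cdf rho (- x))%:E.
Proof.
have e : (Q x [set 1%R] + Q x [set (-1)%R] = 1)%E.
  rewrite -(probability_setT (Q x)).
  have := ge0_integral_two_atoms (one_neqN1 R) (quantize_support x)
    (measurable_cst (1%E : \bar R)) (fun=> lee01).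
  by rewrite integral_cst// !mul1e => ->.
by rewrite EFinB -e quantizeN1 addeK.
Qed.

(** Both 1 and -1 have positive mass under Q 0, so a null set of Q 0 avoids
    them. *)
Lemma quantize_dominates (x : R) : Q x `<< Q 0.
Proof.
apply/null_content_dominatesP => A mA QA.
have QA0 y : y \in A -> Q 0 [set y] = 0%E.
  move=> /set_mem Ay.
  by apply: (@subset_measure0 _ _ _ (Q 0) _ A) => // _ ->.
apply: (two_atoms_null (quantize_support x)) => //; apply/negP => /QA0.
- by rewrite quantize1 oppr0 law_cdf0 => -[]; lra.
- by rewrite quantizeN1 oppr0 law_cdf0 => -[]; lra.
Qed.

Lemma quantize_has_overlap : has_overlap Q.
Proof.
move=> x; split; first exact: quantize_dominates.
apply: (Lfun2_two_atoms (one_neqN1 R) (quantize_support 0)).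
exact/measurable_channel_density/quantize_dominates.
Qed.

(** Both points have mass 1/2 under Q 0, so [channel_density_atom] gives the
    densities 1 + 2 g and 1 - 2 g for g = centered_cdf rho, and the integral
    over Q 0 is the mean of two values. *)
Lemma overlap_quantize :
  overlap Q = separable 4 (centered_cdf rho) (centered_cdf rho).
Proof.
have q1 x : channel_density Q x 1 = 1 + 2 * centered_cdf rho x.
  have := channel_density_atom 1 (quantize_dominates x).
  rewrite !quantize1 oppr0 law_cdf0 -EFinM => -[].
  by rewrite /centered_cdf; lra.
have qN1 x : channel_density Q x (-1) = 1 - 2 * centered_cdf rho x.
  have := channel_density_atom (-1) (quantize_dominates x).
  rewrite !quantizeN1 oppr0 law_cdf0 -EFinM => -[].
  by rewrite /centered_cdf; lra.
have mQ x := measurable_channel_density (quantize_dominates x).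
have integralQ0 f : measurable_fun setT f ->
    \int[Q 0]_y f y = (f 1 + f (-1)) / 2.
  move=> mf.
  transitivity (f 1 * fine (Q 0 [set 1]) + f (-1) * fine (Q 0 [set -1])).
    exact: (Rintegral_two_atoms (one_neqN1 R) (quantize_support 0)).
  by rewrite quantize1 quantizeN1 oppr0 law_cdf0 /=; field.
apply/funext => -[x y]; rewrite /overlap integralQ0 ?q1 ?qN1.
  by rewrite /separable/=; field.
by apply: measurable_funM; apply: measurable_funB.
Qed.

Lemma derive_centered_cdf (x : R) :
  derivable (centered_cdf rho) x 1 /\ (centered_cdf rho)^`()%classic x = p x.
Proof.
have [dF F'] := derive_law_cdf (- x).
have dc : derivable (law_cdf rho \o -%R) x 1.
  by apply/derivable1_diffP/differentiable_comp => //; exact/derivable1_diffP.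
have -> : centered_cdf rho = cst 2^-1 - (law_cdf rho \o -%R) by [].
split; first exact: derivableB.
rewrite derive1E deriveB// derive_cst sub0r -derive1E derive1_comp// F'.
by rewrite [X in _ * X]derive1E derive_val mulrN1 opprK -p_even.
Qed.

End quantized_additive_noise.

Theorem theorem3p32 (R : realType) (rho : probability R R) (p : R -> R)
    (p_density : forall B : set R, measurable B ->
       rho B = (\int[lebesgue_measure]_(y in B) (p y)%:E)%E)
    (p_gt0 : forall y, 0 < p y)
    (p_C4 : C_on_R 4 p)
    (p_even : forall y, p y = p (- y))
    (b : bool) :
  let Q := quantize b (additive_noise rho) in
  has_overlap Q /\
  (forall A : R, 0 < A ->
     exists U : set (R * R),
       [/\ open U, `[- A, A] `*` `[- A, A] `<=` U & C_on 4 U (overlap Q)]) /\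
  partial1 (partial1 (partial2 (overlap Q))) (0, 0) = 0 /\
  fisher_information Q = 4 * p 0 ^+ 2.
Proof.
move=> Q.
have p_ge0 y : 0 <= p y by exact: ltW.
have p_cont : continuous p := C_on_R_continuous p_C4.
have dp : forall x, derivable p x 1 := ((C_on_RS _ _).1 p_C4).1.
have dg x := derive_centered_cdf p_density p_ge0 p_cont p_even x.
have d1g x : derivable (centered_cdf rho) x 1 := (dg x).1.
have g'E : (centered_cdf rho)^`()%classic = p.
  by apply/funext => x; rewrite (dg x).2.
(* The class C^5 of centered_cdf rho comes from its derivative p being C^4. *)
have g_C4 : C_on_R 4 (centered_cdf rho).
  by apply/C_on_RW/C_on_RS; rewrite g'E.
split; first exact: quantize_has_overlap p_density p_ge0 p_cont p_even b.
rewrite /fisher_information.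
rewrite (overlap_quantize p_density p_ge0 p_cont p_even b).
split.
  by move=> A _; exists setT; split => //; [exact: openT|exact: C_on_separable].
rewrite (partial2_separable _ _ d1g) (partial1_separable _ _ d1g) g'E.
rewrite (partial1_separable _ _ dp); split.
  by rewrite /separable derive1_even0// mulr0 mul0r.
by rewrite /separable /=; ring.
Qed.
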